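(* Let $\frac12<p<1$ and let $f:\mathbb{Z}^+\to[0,\infty)$ be monotonically increasing (non-decreasing). Let $\{N_j\}_{j\ge0}$ be the discrete-time, time-inhomogeneous Markov chain on $\mathbb{N}=\{0,1,2,\dots\}$ with $N_0=1$, $N_1\sim\mathrm{Bern}\big(\frac{1-p}{p}\big)$, and, for $j\ge1$, conditionally on $N_j$, $$N_{j+1}\sim \mathrm{Bin}\Big(N_j,\tfrac{1-p}{p}\Big)+\mathrm{Poiss}\Big(\tfrac{1-p}{p}f(j)\Big),$$ where the two summands are independent (when $N_j=0$ this is $\mathrm{Poiss}(\frac{1-p}{p}f(j))$). Let $\mathbf{P}^*$ denote its law and let $K=\#\{j\in\mathbb{Z}^+: N_j=0\}$. Then $\mathbf{P}^*(K=\infty)=1$ if and only if $$\sum_{j=1}^{\infty}e^{-\frac{1-p}{2p-1}f(j)}=\infty.$$ Moreover, if this sum is finite, then $\mathbf{P}^*(K=\infty)=0$. *)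

(* Defs.v *)
From HB Require Import structures.
From mathcomp Require Import all_boot all_order all_algebra.
From mathcomp Require Import all_classical all_reals all_analysis.
Set Implicit Arguments. Unset Strict Implicit. Unset Printing Implicit Defensive.
Import Order.TTheory GRing.Theory Num.Theory.
Local Open Scope classical_set_scope.
Local Open Scope ring_scope.

(* Poisson pmf with rate lam >= 0 (lam = 0 gives the point mass at 0). *)
Definition pois_pmf {R : realType} (lam : R) (k : nat) : R :=
  lam ^+ k / k`!%:R * expR (- lam).

(* Transition probability from N_j = n to N_{j+1} = m, with r = (1-p)/p.
   j = 0 : N_1 ~ Bern(r) (= Bin(1, r)).
   j >= 1 : Bin(n, r) + Poiss(r f(j)), independent summands (convolution). *)
Definition trans {R : realType} (p : R) (f : nat -> R) (j n m : nat) : R :=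
  let r := (1 - p) / p in
  if j == 0%N then binomial_pmf 1 r m
  else \sum_(k < m.+1) binomial_pmf n r k * pois_pmf (r * f j) (m - k).

Definition is_chain {R : realType} {d : measure_display} {T : measurableType d}
  (P : probability T R) (p : R) (f : nat -> R) (N : nat -> T -> nat) : Prop :=
  (forall j n, measurable [set w | N j w = n]) /\
  forall (j : nat) (x : nat -> nat),
    P [set w | forall i, (i <= j)%N -> N i w = x i] =
    ((x 0%N == 1%N)%:R * \prod_(i < j) trans p f i (x i) (x i.+1))%:E.

(* Main.v *)
(** Put r = (1-p)/p and c = r/(1-r) = (1-p)/(2p-1). Probability generating functions
give, for m >= 1,
  P(N_n = 0 | N_m = a) = (1 - r^(n-m))^a exp(-L(m,n)),
  L(m,n) = sum_(m <= i < n) r^(n-i) f(i).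
Convexity of exp yields exp(-L(1,n+1)) <= r exp(-L(1,n)) + (1-r) exp(-c f(n)), so if
the series in the theorem converges then so does sum_n P(N_n = 0), and Borel-Cantelli
applies.

If it diverges, monotonicity gives L(1,n) <= c f(n), so W = sum_(m < n <= M) exp(-L(1,n))
tends to infinity with M, and exp(-L(k,n)) <= e exp(-L(1,n)) + r^(n-k)/(1-r) for k <= n.
Started from N_m = a, the expected number of zeros in (m, M] is at least W - O(a); by
decomposition at the first zero it is at most P(some zero in (m, M]) (e W + O(1)). Hence
a further zero occurs with conditional probability at least 1/(2e) given any past, and
therefore almost surely. *)

Require Import Defs.
From HB Require Import structures.
From mathcomp Require Import all_boot all_order all_algebra.
From mathcomp Require Import all_classical all_reals all_analysis.
From mathcomp Require Import ring lra.
Set Implicit Arguments. Unset Strict Implicit. Unset Printing Implicit Defensive.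
Import Order.TTheory GRing.Theory Num.Theory.
Local Open Scope classical_set_scope.
Local Open Scope ring_scope.

(** * Generating functions of the binomial and Poisson laws *)

Section GeneratingFunctions.
Context {R : realType}.
Implicit Types (a b n m k : nat) (p r s lam x : R) (f : nat -> R).

Lemma exp_eseries x : 0 <= x ->
  (\sum_(0 <= k <oo) (x ^+ k / k`!%:R)%:E)%E = (expR x)%:E.
Proof.
move=> x0; apply/cvg_lim => //.
under eq_fun do rewrite sumEFin.
apply: cvg_EFin; first exact: nearW.
exact: (is_cvg_series_exp_coeff x).
Qed.

Lemma pois_pmf_ge0 lam k : 0 <= lam -> 0 <= pois_pmf lam k.
Proof.
by move=> ?; rewrite mulr_ge0 ?expR_ge0// divr_ge0// exprn_ge0.
Qed.

Lemma pois_pgf lam s : 0 <= lam -> 0 <= s ->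
  (\sum_(0 <= k <oo) (pois_pmf lam k * s ^+ k)%:E)%E
  = (expR (- (lam * (1 - s))))%:E.
Proof.
move=> lam0 s0.
have -> : expR (- (lam * (1 - s))) = expR (- lam) * expR (lam * s).
  by rewrite -expRD; congr expR; ring.
rewrite EFinM -(@exp_eseries (lam * s)) ?mulr_ge0// -nneseriesZl; last first.
  by move=> k _; rewrite lee_fin divr_ge0// exprn_ge0// mulr_ge0.
apply: eq_eseriesr => k _; rewrite -EFinM; congr EFin.
by rewrite /pois_pmf exprMn; ring.
Qed.

Lemma binomial_pgf n r s :
  \sum_(k < n.+1) binomial_pmf n r k * s ^+ k = (1 - r + r * s) ^+ n.
Proof.
rewrite exprDn; apply: eq_bigr => k _.
by rewrite /binomial_pmf /unstable.onem exprMn mulrnAl mulrA [_ * r ^+ k]mulrC.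
Qed.

(** [binomial_pmf n r] vanishes beyond [n], so the range of summation can be made independent of
    [m], which allows the exchange with a series over [m]. The test [k <= m] guards the truncated
    subtraction. *)
Lemma binomial_convE n r (g : nat -> R) m :
  \sum_(k < m.+1) binomial_pmf n r k * g (m - k)%N
  = \sum_(k < n.+1) binomial_pmf n r k * (if (k <= m)%N then g (m - k)%N else 0).
Proof.
pose F k := binomial_pmf n r k * (if (k <= m)%N then g (m - k)%N else 0).
have FE j : (m <= j)%N \/ (n <= j)%N -> (forall i, (minn m n < i)%N -> F i = 0) ->
    \sum_(k < j.+1) F k = \sum_(k < (minn m n).+1) F k.
  move=> jmn F0.
  have mj : ((minn m n).+1 <= j.+1)%N by case: jmn => h; rewrite ltnS geq_min h ?orbT.
  rewrite [RHS](@big_ord_widen _ _ _ _ j.+1 F)//.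
  rewrite [RHS]big_mkcond/=; apply: eq_bigr => i _; case: ifPn => //.
  by rewrite -leqNgt; exact: F0.
have F0 i : (minn m n < i)%N -> F i = 0.
  rewrite gtn_min => /orP[mi|ni]; rewrite /F.
    by rewrite leqNgt mi mulr0.
  by rewrite /binomial_pmf bin_small// mulr0n mul0r.
transitivity (\sum_(k < m.+1) F k).
  by apply: eq_bigr => i _; rewrite /F -ltnS ltn_ord.
by rewrite (FE m) 1?(FE n)//; [right|left].
Qed.

Lemma shifted_eseries (g : nat -> R) k : (forall i, 0 <= g i) ->
  (\sum_(0 <= m <oo) (if (k <= m)%N then g (m - k)%N else 0)%:E)%E
  = (\sum_(0 <= m <oo) (g m)%:E)%E.
Proof.
move=> g0.
rewrite (@nneseries_split _ _ 0 k); last by move=> i _; case: ifP; rewrite lee_fin.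
rewrite big_nat big1; last by move=> i /andP[_ ik]; rewrite leqNgt ik.
rewrite add0e add0n -nneseries_addn; last by move=> i; case: ifP; rewrite lee_fin.
by apply: eq_eseriesr => i _; rewrite leq_addl addnK.
Qed.

(** The generating function of a sum of independent variables is the product of theirs: for each
    fixed [k] the sum over [m] is the Poisson series shifted by [k]. *)
Lemma conv_pgf n r lam s : 0 <= r <= 1 -> 0 <= lam -> 0 <= s ->
  (\sum_(0 <= m <oo)
     ((\sum_(k < m.+1) binomial_pmf n r k * pois_pmf lam (m - k)) * s ^+ m)%:E)%E
  = ((1 - r + r * s) ^+ n * expR (- (lam * (1 - s))))%:E.
Proof.
move=> r01 lam0 s0.
have b0 k : 0 <= binomial_pmf n r k * s ^+ k.
  by rewrite mulr_ge0 ?exprn_ge0 ?binomial_pmf_ge0.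
have p0 k : 0 <= pois_pmf lam k * s ^+ k.
  by rewrite mulr_ge0 ?exprn_ge0 ?pois_pmf_ge0.
pose G k m := ((binomial_pmf n r k * s ^+ k)%:E *
  (if (k <= m)%N then pois_pmf lam (m - k) * s ^+ (m - k) else 0)%:E)%E.
transitivity (\sum_(0 <= m <oo) \sum_(k < n.+1) G k m)%E.
  apply: eq_eseriesr => m _; rewrite binomial_convE mulr_suml -sumEFin.
  apply: eq_bigr => k _; rewrite /G -EFinM; congr EFin; case: ifP => km.
    have -> : s ^+ m = s ^+ k * s ^+ (m - k) by rewrite -exprD subnKC.
    by rewrite mulrACA.
  by rewrite !mulr0 mul0r.
have if0 k m : 0 <= if (k <= m)%N then pois_pmf lam (m - k) * s ^+ (m - k) else 0.
  by case: ifP.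
rewrite nneseries_sum; last by move=> k m _; rewrite /G -EFinM lee_fin mulr_ge0.
transitivity (\sum_(k < n.+1) (binomial_pmf n r k * s ^+ k)%:E *
    (expR (- (lam * (1 - s))))%:E)%E.
  apply: eq_bigr => k _; rewrite nneseriesZl//.
    by rewrite (@shifted_eseries (fun i => pois_pmf lam i * s ^+ i))// pois_pgf.
  by move=> m _; rewrite lee_fin.
by rewrite -binomial_pgf mulr_suml -sumEFin; apply: eq_bigr => k _; rewrite EFinM.
Qed.

End GeneratingFunctions.

(* [load r f m n] is the mean number at time [n] of the immigrants of steps [m, ..., n - 1]. *)
Definition load {R : realType} (r : R) (f : nat -> R) (m n : nat) : R :=
  \sum_(m <= i < n) r ^+ (n - i) * f i.

(** * Estimates for the accumulated immigration *)

Section Load.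
Context {R : realType} {r : R} {f : nat -> R}.
Hypotheses (r0 : 0 < r) (r1 : r < 1).
Implicit Types k m n : nat.
Local Notation c := (r / (1 - r)).
Local Notation load := (load r f).

Let r_ge0 : 0 <= r. Proof. exact: ltW. Qed.
Let r_le1 : r <= 1. Proof. exact: ltW. Qed.
Let onemr_gt0 : 0 < 1 - r. Proof. by rewrite subr_gt0. Qed.

Lemma load_nn n : load n n = 0.
Proof. by rewrite /load big_geq. Qed.

Lemma load_recl m n : (m < n)%N -> load m n = r ^+ (n - m) * f m + load m.+1 n.
Proof. by move=> mn; rewrite /load big_ltn. Qed.

Lemma load_recr m n : (m <= n)%N -> load m n.+1 = r * (load m n + f n).
Proof.
move=> mn; rewrite /load big_nat_recr//= subSnn expr1 mulrDr; congr (_ + _).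
rewrite mulr_sumr big_nat [RHS]big_nat; apply: eq_bigr => i /andP[_ /ltnW ni].
by rewrite subSn// exprS mulrA.
Qed.

Lemma load_split k m n : (k <= m <= n)%N ->
  load k n = r ^+ (n - m) * load k m + load m n.
Proof.
move=> /andP[km]; elim: n => [|n IH].
  by rewrite leqn0 => /eqP ->; rewrite load_nn subnn expr0 mul1r addr0.
rewrite leq_eqVlt ltnS => /orP[/eqP ->|mn].
  by rewrite load_nn subnn expr0 mul1r addr0.
rewrite !load_recr ?(leq_trans km)// IH// subSn// exprS; ring.
Qed.

Hypothesis f_ge0 : forall j, (0 < j)%N -> 0 <= f j.

Lemma load_ge0 m n : (0 < m)%N -> 0 <= load m n.
Proof.
move=> m0; rewrite /load big_nat; apply: sumr_ge0 => i /andP[mi _].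
by rewrite mulr_ge0 ?exprn_ge0// f_ge0// (leq_trans m0).
Qed.

Let c_ge0 : 0 <= c. Proof. by rewrite divr_ge0// ltW. Qed.
Let cE : r * (c + 1) = c. Proof. by field; rewrite gt_eqF. Qed.

(* Convexity of [exp]: [load 1 n.+1] is the barycentre of [load 1 n] and [c * f n]
   with weights [r] and [1 - r]. *)
Lemma expRN_load_rec n : (0 < n)%N -> expR (- load 1 n.+1) <=
  r * expR (- load 1 n) + (1 - r) * expR (- (c * f n)).
Proof.
move=> n0.
have := convex_expR (Itv01 r_ge0 r_le1) (- load 1 n) (- (c * f n)).
rewrite !convRE/= => /(le_trans _); apply; rewrite ler_expR load_recr//.
rewrite /unstable.onem le_eqVlt; apply/orP; left; apply/eqP.
by field; rewrite gt_eqF.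
Qed.

(** [expRN_load_rec] summed over time, a share [r] of each term being absorbed on the left. The
    constant 1 is [expR (- load 1 1)], and the trailing term on the left keeps the induction
    going. *)
Lemma sum_expRN_load n :
  (1 - r) * \sum_(1 <= k < n.+1) expR (- load 1 k) + expR (- load 1 n.+1) <=
  1 + (1 - r) * \sum_(1 <= k < n.+1) expR (- (c * f k)).
Proof.
elim: n => [|n IH].
  by rewrite !big_geq// !mulr0 add0r addr0 load_nn oppr0 expR0.
rewrite !(@big_nat_recr _ _ _ n.+1)//=; have := @expRN_load_rec n.+1 isT; lra.
Qed.

Hypothesis f_nd : forall i j, (0 < i)%N -> (i <= j)%N -> f i <= f j.

(** [c * f n] is the fixed point of [x |-> r * (x + f n)], the recursion of [load_recr];
    monotonicity carries the bound from [f n] to [f n.+1]. *)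
Lemma load_le m n : (0 < m)%N -> (m <= n)%N -> load m n <= c * f n.
Proof.
move=> m0; elim: n => [|n IH]; first by rewrite leqn0 => /eqP mE; rewrite mE in m0.
rewrite leq_eqVlt => /orP[/eqP <-|]; first by rewrite load_nn mulr_ge0// f_ge0.
rewrite ltnS => mn; have n0 := leq_trans m0 mn; rewrite load_recr//.
rewrite (@le_trans _ _ (c * f n))//; last by rewrite ler_wpM2l// f_nd.
by rewrite -cE -mulrA ler_wpM2l// mulrDl mul1r lerD2r IH.
Qed.

(** Replacing every [f i] by the smallest value [f m] leaves a geometric sum, which equals the
    left-hand side. *)
Lemma load_ge m n : (0 < m)%N -> (m <= n)%N ->
  c * f m * (1 - r ^+ (n - m)) <= load m n.
Proof.
move=> m0; elim: n => [|n IH]; first by rewrite leqn0 => /eqP mE; rewrite mE in m0.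
rewrite leq_eqVlt => /orP[/eqP <-|].
  by rewrite load_nn subnn expr0 subrr mulr0.
rewrite ltnS => mn; rewrite load_recr// subSn//.
apply: (@le_trans _ _ (r * (c * f m * (1 - r ^+ (n - m)) + f m))).
  rewrite exprS le_eqVlt; apply/orP; left; apply/eqP.
  by field; rewrite gt_eqF.
by rewrite ler_wpM2l// lerD ?IH// f_nd.
Qed.

Lemma expRN_le_inv (x : R) : 0 < x -> expR (- x) <= x^-1.
Proof.
move=> x0; rewrite expRN lef_pV2 ?posrE ?expR_gt0//.
by rewrite (le_trans _ (expR_ge1Dx x))// lerDr.
Qed.

(* The two terms correspond to [r ^+ (n - m) * (c * f m)] being at most, resp.
   larger than, 1. *)
Lemma expRN_load_le m n : (0 < m)%N -> (m <= n)%N ->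
  expR (- load m n) <= expR 1 * expR (- load 1 n) + (1 - r)^-1 * r ^+ (n - m).
Proof.
move=> m0; rewrite leq_eqVlt => /orP[/eqP <-|mn].
  rewrite load_nn oppr0 expR0 subnn expr0 mulr1 ler_wpDl ?mulr_ge0 ?expR_ge0//.
  by rewrite invf_ge1// gerBl.
set q := r ^+ (n - m); set A := c * f m.
have q0 : 0 < q by rewrite exprn_gt0.
have A0 : 0 <= A by rewrite mulr_ge0// f_ge0.
have sE : load 1 n = q * load 1 m + load m n by rewrite (@load_split 1 m n)// m0 ltnW.
have l1 : load 1 m <= A by rewrite load_le.
have [qA|qA] := leP (q * A) 1.
  rewrite -expRD -[leLHS]addr0 lerD ?mulr_ge0 ?invr_ge0//; try exact: ltW.
  rewrite ler_expR sE; have : q * load 1 m <= q * A by rewrite ler_wpM2l// ltW.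
  lra.
(* Here [A > q^-1], and [q <= r] because [m < n]; hence [load_ge] gives [load m n >= (1 - r) / q],
   and [expR (- x) <= x^-1] yields the second term alone. *)
rewrite -[leLHS]add0r lerD ?mulr_ge0 ?expR_ge0//.
have qr : q <= r by rewrite /q -(subnSK mn) exprS ler_piMr// exprn_ile1.
have -> : (1 - r)^-1 * q = ((1 - r) / q)^-1 by rewrite invf_div mulrC.
have /expRN_le_inv : 0 < (1 - r) / q by rewrite divr_gt0.
apply: le_trans.
rewrite ler_expR lerN2 (le_trans _ (load_ge m0 (ltnW mn)))//.
rewrite -/A -/q mulrC ler_pM ?invr_ge0 ?(ltW q0) ?(ltW onemr_gt0)//; last lra.
by rewrite -[q^-1]mul1r ler_pdivrMr// mulrC ltW.
Qed.

End Load.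

(** * Events determined by the past, as countable unions of cylinders *)

Section History.
Context {R : realType} {d : measure_display} {T : measurableType d}.
Variables (P : probability T R) (N : nat -> T -> nat).
Hypothesis mN : forall j n, measurable [set w | N j w = n].
Implicit Types (i j k m n a : nat) (x : nat -> nat) (E B : set T) (w : T) (c : R).

Definition cylinder j x : set T := [set w | forall i, (i <= j)%N -> N i w = x i].

(* [E] belongs to the sigma-field generated by [N 0, ..., N j]. *)
Definition past j E :=
  forall w w', (forall i, (i <= j)%N -> N i w = N i w') -> E w -> E w'.

(** Histories up to time [j] are finite sequences of naturals, hence countable; numbering them makes
    the fibers of [code j] a countable partition of [T] whose nonempty cells are cylinders. *)
Let code j w : nat := pickle (mkseq (N^~ w) j.+1).

Let codeP j w w' : code j w = code j w' <-> forall i, (i <= j)%N -> N i w = N i w'.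
Proof.
split=> [/(pcan_inj pickleK) e i ij|e].
  have := congr1 (fun s => nth 0%N s i) e.
  by rewrite !nth_mkseq.
congr pickle; apply: (@eq_from_nth _ 0%N) => [|i]; rewrite !size_mkseq// => ij.
by rewrite !nth_mkseq// e.
Qed.

Let fiber j k : set T := [set w | code j w = k].

(** An event of the past contains every fiber that it meets. *)
Let past_fiber j E k : past j E ->
  E `&` fiber j k = set0 \/ exists2 w0, E w0 & E `&` fiber j k = cylinder j (N^~ w0).
Proof.
move=> pE; have [->|/set0P[w0 [Ew0 kw0]]] := eqVneq (E `&` fiber j k) set0.
  by left.
right; exists w0 => //; apply/seteqP; split=> w /=.
  by move=> [_ kw]; apply/codeP; rewrite kw kw0.
move=> ww0; split; first by apply: pE Ew0 => i /ww0.
by rewrite /fiber/= -kw0; apply/codeP.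
Qed.

Let fiberT j E : E = \bigcup_k (E `&` fiber j k).
Proof.
apply/seteqP; split=> [w Ew|w [k _ []]]//.
by exists (code j w).
Qed.

Let fiber_triv j E : trivIset [set: nat] (fun k => E `&` fiber j k).
Proof. by move=> k k' _ _ [w [[_ <-] [_ <-]]]. Qed.

Lemma measurable_cylinder j x : measurable (cylinder j x).
Proof.
have -> : cylinder j x = \bigcap_(i in [set i | (i <= j)%N]) [set w | N i w = x i].
  by apply/seteqP; split.
by apply: bigcap_measurable => //; exists 0%N.
Qed.

Lemma measurable_past j E : past j E -> measurable E.
Proof.
move=> pE; rewrite (fiberT j E); apply: bigcupT_measurable => k.
have [->|[w0 _ ->]] := past_fiber k pE; first exact: measurable0.
exact: measurable_cylinder.
Qed.

Let mfiber j k : measurable (fiber j k).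
Proof.
apply: (@measurable_past j) => w w' ww'; rewrite /fiber/= => <-.
by apply/esym/codeP.
Qed.

Let measure_fiber j E : measurable E ->
  P E = (\sum_(0 <= k <oo) P (E `&` fiber j k))%E.
Proof.
move=> mE; rewrite {1}(fiberT j E) measure_semi_bigcup//.
  by move=> k; apply: measurableI.
by rewrite -fiberT.
Qed.

(** Sum over the cylinders that make up [E]. This stands in for conditioning on the past: only
    cylinders, whose probabilities [is_chain] prescribes, have to be examined. *)
Lemma past_prob_eq j E B c : past j E -> measurable B ->
  (forall w, E w -> P (cylinder j (N^~ w) `&` B) = c%:E * P (cylinder j (N^~ w)))%E ->
  (P (E `&` B) = c%:E * P E)%E.
Proof.
move=> pE mB H; have mE := measurable_past pE.
rewrite (@measure_fiber j (E `&` B)); last exact: measurableI.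
rewrite (measure_fiber j mE) -nneseriesZl//; apply: eq_eseriesr => k _.
rewrite setIAC; have [->|[w0 Ew0 ->]] := past_fiber k pE; last exact: H.
by rewrite set0I measure0 mule0.
Qed.

Lemma past_prob_le j E B c : past j E -> measurable B ->
  (forall w, E w -> P (cylinder j (N^~ w) `&` B) <= c%:E * P (cylinder j (N^~ w)))%E ->
  (P (E `&` B) <= c%:E * P E)%E.
Proof.
move=> pE mB H; have mE := measurable_past pE.
rewrite (@measure_fiber j (E `&` B)); last exact: measurableI.
rewrite (measure_fiber j mE) -nneseriesZl//; apply: lee_nneseries => // k _.
rewrite setIAC; have [->|[w0 Ew0 ->]] := past_fiber k pE; last exact: H.
by rewrite set0I measure0 mule0.
Qed.

Lemma past_cylinder j x : past j (cylinder j x).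
Proof. by move=> w w' ww' cw i ij; rewrite -ww'// cw. Qed.

End History.

(** * The Markov property and the probability of a zero *)

Section Markov.
Context {R : realType} {d : measure_display} {T : measurableType d}.
Variables (P : probability T R) (p : R) (f : nat -> R) (N : nat -> T -> nat).
Hypotheses (p_gt : 1 / 2 < p) (p_lt1 : p < 1).
Hypothesis f_ge0 : forall j, (0 < j)%N -> 0 <= f j.
Hypothesis chainN : is_chain P p f N.
Implicit Types (j m n a : nat) (x : nat -> nat) (E : set T).
Local Notation r := ((1 - p) / p).
Local Notation zero n := [set w | N n w = 0%N].

Let mN := chainN.1.

Let p_gt0 : 0 < p. Proof. by rewrite (lt_trans _ p_gt)// divr_gt0. Qed.

Lemma ratio_gt0 : 0 < r.
Proof. by rewrite divr_gt0// subr_gt0. Qed.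

Lemma ratio_lt1 : r < 1.
Proof.
rewrite ltr_pdivrMr// mul1r ltrBlDr -mulr2n -mulr_natr.
by rewrite -ltr_pdivrMr.
Qed.

Let r01 : 0 <= r <= 1.
Proof. by rewrite (ltW ratio_gt0) (ltW ratio_lt1). Qed.

Let rate_ge0 j : (0 < j)%N -> 0 <= r * f j.
Proof. by move=> j0; exact: mulr_ge0 (ltW ratio_gt0) (f_ge0 j0). Qed.

Lemma transE j n m : (0 < j)%N -> trans p f j n m =
  \sum_(k < m.+1) binomial_pmf n r k * pois_pmf (r * f j) (m - k).
Proof. by case: j. Qed.

Lemma trans_ge0 j n m : (0 < j)%N -> 0 <= trans p f j n m.
Proof.
move=> j0; rewrite transE// sumr_ge0// => k _.
by rewrite mulr_ge0 ?binomial_pmf_ge0 ?pois_pmf_ge0 ?rate_ge0.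
Qed.

Lemma trans_pgf j n s : (0 < j)%N -> 0 <= s ->
  (\sum_(0 <= m <oo) (trans p f j n m * s ^+ m)%:E)%E
  = ((1 - r + r * s) ^+ n * expR (- (r * f j * (1 - s))))%:E.
Proof.
move=> j0 s0; rewrite -conv_pgf ?rate_ge0//.
by apply: eq_eseriesr => m _; rewrite transE.
Qed.

(** The path [x] up to time [j], continued by [b]; beyond [j] only the value at [j.+1] matters,
    since cylinders ending there are the ones considered. *)
Let upd x j b := fun i => if (i <= j)%N then x i else b.

Let cylinder_step j x b :
  cylinder N j.+1 (upd x j b) = cylinder N j x `&` [set w | N j.+1 w = b].
Proof.
apply/seteqP; split=> w /=.
  move=> H; split=> [i ij|]; first by rewrite H ?(leqW ij)// /upd ij.
  by rewrite H// /upd ltnn.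
move=> [H Hb] i; rewrite leq_eqVlt ltnS /upd => /orP[/eqP ->|ij].
  by rewrite ltnn.
by rewrite ij H.
Qed.

Let prob_cylinder_step j x b :
  (P (cylinder N j.+1 (upd x j b)) = P (cylinder N j x) * (trans p f j (x j) b)%:E)%E.
Proof.
rewrite /cylinder !chainN.2 -EFinM; congr EFin.
rewrite big_ord_recr/= /upd leq0n leqnn ltnn mulrA; congr (_ * _ * _).
by apply: eq_bigr => i _; rewrite ltn_ord ltnW.
Qed.

(** The two factors say that no individual present at time [m] has survived and that no later
    immigrant has. Induction on [l], conditioning on the value [b] at time [m.+1]: the sum over [b]
    is [trans_pgf] at [s = 1 - r ^+ l]. *)
Lemma markov_cylinder_zero l m x : (0 < m)%N ->
  (P (cylinder N m x `&` zero (m + l)) =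
   ((1 - r ^+ l) ^+ x m * expR (- load r f m (m + l)))%:E * P (cylinder N m x))%E.
Proof.
elim: l m x => [|l IH] m x m0.
  rewrite addn0 expr0 subrr load_nn oppr0 expR0 mulr1.
  (* For [l = 0] the first factor is [0 ^+ x m], the indicator of [x m = 0]. *)
  have [xm0|xm0] := eqVneq (x m) 0%N.
    rewrite xm0 expr0 mul1e; congr (P _); apply/seteqP; split=> w /=; first by case.
    by move=> cw; split=> //; rewrite -xm0 cw.
  rewrite expr0n (negbTE xm0) mul0e -(measure0 P); congr (P _).
  rewrite -subset0 => w [cw /= Nw0].
  by move/negP: xm0; apply; apply/eqP; rewrite -cw.
set n := (m + l.+1)%N; pose A b := cylinder N m.+1 (upd x m b) `&` zero n.
have mA b : measurable (A b) by apply: measurableI => //; exact: measurable_cylinder.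
have -> : cylinder N m x `&` zero n = \bigcup_b A b.
  apply/seteqP; split=> w /=.
    by move=> [cw zw]; exists (N m.+1 w) => //; split=> //; rewrite cylinder_step.
  by move=> [b _ [+ zw]]; rewrite cylinder_step => -[].
rewrite measure_semi_bigcup//; last 2 first.
- move=> b b' _ _ [w [[+ _] [+ _]]]; rewrite !cylinder_step.
  by move=> [_ <-] [_ <-].
- exact: bigcupT_measurable.
have Pfin : P (cylinder N m x) \is a fin_num.
  exact/fin_num_measure/measurable_cylinder.
rewrite -(fineK Pfin); set pi := fine _; set L := load r f m.+1 n.
have s0 : 0 <= 1 - r ^+ l.
  by rewrite subr_ge0 exprn_ile1 ?(ltW ratio_gt0) ?(ltW ratio_lt1).
transitivity (\sum_(0 <= b <oo)
    (pi * expR (- L))%:E * (trans p f m (x m) b * (1 - r ^+ l) ^+ b)%:E)%E.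
  apply: eq_eseriesr => b _; have := IH m.+1 (upd x m b) isT.
  rewrite addSn -addnS -/n -/(A b) -/L => H; apply: (eq_trans H).
  rewrite prob_cylinder_step -(fineK Pfin) -/pi -!EFinM; congr EFin.
  by rewrite /upd ltnn; ring.
rewrite nneseriesZl; last first.
  by move=> b _; rewrite lee_fin mulr_ge0 ?exprn_ge0 ?trans_ge0.
rewrite trans_pgf// -!EFinM; congr EFin.
(* The extinction factor thus passes from [l] to [l.+1]; the Poisson exponent treated below is the
   term [i = m] of [load r f m n]. *)
have -> : 1 - r + r * (1 - r ^+ l) = 1 - r ^+ l.+1 by rewrite exprS; ring.
rewrite (@load_recl _ _ _ m n); last by rewrite /n addnS ltnS leq_addr.
have -> : r * f m * (1 - (1 - r ^+ l)) = r ^+ l.+1 * f m by rewrite exprS; ring.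
rewrite -/L opprD expRD /n addKn.
ring.
Qed.

Lemma markov_zero m n a E : (0 < m)%N -> (m <= n)%N -> past N m E ->
  E `<=` [set w | N m w = a] ->
  (P (E `&` zero n) = ((1 - r ^+ (n - m)) ^+ a * expR (- load r f m n))%:E * P E)%E.
Proof.
move=> m0 mn pE Ea; apply: (past_prob_eq mN pE) => // w Ew.
by rewrite -{1}(subnKC mn) markov_cylinder_zero// (subnKC mn) (Ea _ Ew).
Qed.

End Markov.

Lemma sum_geometric_le {R : realType} (r : R) n : 0 <= r < 1 ->
  \sum_(0 <= i < n) r ^+ i <= (1 - r)^-1.
Proof.
move=> /andP[r0 r1]; rewrite -[leRHS]mul1r ler_pdivlMr ?subr_gt0// mulrC.
by rewrite big_mkord -opprB mulNr -subrX1 opprB gerBl exprn_ge0.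
Qed.

(** * Returns to zero: first-zero decomposition and a uniform chance of return *)

Section Returns.
Context {R : realType} {d : measure_display} {T : measurableType d}.
Variables (P : probability T R) (p : R) (f : nat -> R) (N : nat -> T -> nat).
Hypotheses (p_gt : 1 / 2 < p) (p_lt1 : p < 1).
Hypothesis f_ge0 : forall j, (0 < j)%N -> 0 <= f j.
Hypothesis f_nd : forall i j, (0 < i)%N -> (i <= j)%N -> f i <= f j.
Hypothesis chainN : is_chain P p f N.
Implicit Types (i j k m n a M : nat) (E B : set T).
Local Notation r := ((1 - p) / p).
Local Notation zero n := [set w | N n w = 0%N].
Local Notation load := (load r f).

Let mN := chainN.1.
Let r0 : 0 < r := ratio_gt0 p_gt p_lt1.
Let r1 : r < 1 := ratio_lt1 p_gt.
(** Probabilities as real numbers, so that they can be subtracted freely. *)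
Let pr E : R := fine (P E).

Let prE E : measurable E -> P E = (pr E)%:E.
Proof. by move=> mE; rewrite /pr fineK// fin_num_measure. Qed.

Let pr_ge0 E : 0 <= pr E. Proof. exact: fine_ge0. Qed.

Let pr_split A B : measurable A -> measurable B ->
  pr A = pr (A `&` B) + pr (A `\` B).
Proof.
move=> mA mB; apply: EFin_inj; rewrite EFinD -!prE.
- by rewrite addeC -measureDI.
- exact: measurableD.
- exact: measurableI.
- exact: mA.
Qed.

Let pr_markov m n a E : (0 < m)%N -> (m <= n)%N -> past N m E ->
  E `<=` [set w | N m w = a] ->
  pr (E `&` zero n) = (1 - r ^+ (n - m)) ^+ a * expR (- load m n) * pr E.
Proof.
move=> m0 mn pE Ea; have mE := measurable_past mN pE; apply: EFin_inj.
rewrite EFinM -!prE//; last exact: measurableI.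
exact: (markov_zero p_gt p_lt1 f_ge0 chainN).
Qed.

Definition avoid m n : set T := [set w | forall i, (m < i <= n)%N -> N i w <> 0%N].
Definition avoid_forever m : set T := [set w | forall i, (m < i)%N -> N i w <> 0%N].

Lemma past_avoid m n : past N n (avoid m n).
Proof.
by move=> w w' ww' aw i /andP[mi ni]; rewrite -ww'//; apply: aw; rewrite mi.
Qed.

Lemma pastI n E B : past N n E -> past N n B -> past N n (E `&` B).
Proof. by move=> pE pB w w' ww' [/(pE _ _ ww') ? /(pB _ _ ww')]. Qed.

Lemma pastS m n E : (m <= n)%N -> past N m E -> past N n E.
Proof. by move=> mn pE w w' ww'; apply: pE => i im; apply: ww'; exact: leq_trans mn. Qed.

Lemma past_zero n : past N n (zero n).
Proof. by move=> w w' ww' /=; rewrite ww'. Qed.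

Let mavoid m n : measurable (avoid m n) := measurable_past mN (@past_avoid m n).

Lemma avoidS m n : (m <= n)%N -> avoid m n.+1 = avoid m n `\` zero n.+1.
Proof.
move=> mn; apply/seteqP; split=> w /=.
  move=> aw; split=> [i /andP[mi ni]|]; first by apply: aw; rewrite mi leqW.
  by apply: aw; rewrite ltnS mn/=.
move=> [aw zw] i /andP[mi]; rewrite leq_eqVlt => /orP[/eqP ->//|ni].
by apply: aw; rewrite mi.
Qed.

Lemma measurable_avoid_forever m : measurable (avoid_forever m).
Proof.
have -> : avoid_forever m = \bigcap_n avoid m n.
  apply/seteqP; split=> w /= aw; first by move=> n _ i /andP[mi _]; exact: aw.
  by move=> i mi; apply: (aw i) => //; rewrite mi/=.
exact: bigcapT_measurable.
Qed.

(** Infinitely many zeros means that there is no last one. The shift to [m.+1] makes the starting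
    times positive, as the Markov formula requires. *)
Lemma infinite_zerosE :
  [set w | infinite_set [set j | (0 < j)%N /\ N j w = 0%N]] =
  ~` (\bigcup_m avoid_forever m.+1).
Proof.
apply/seteqP; split=> w /=.
  move=> iw [m _ aw]; apply: iw; apply: (@sub_finite_set _ _ `I_m.+2).
    move=> j [j0 zj] /=; rewrite ltnNge; apply/negP => mj; exact: (aw j).
  exact: finite_II.
move=> nw fw; apply: nw; have [s sE] := (@finite_seqP _ _).1 fw.
(* The largest zero (0 if there is none) bounds the times at which zeros occur. *)
exists (\max_(j <- s) j) => // i si zi.
have : i \in s.
  have : [set` s] i by rewrite -sE /=; split=> //; exact: leq_ltn_trans si.
  by [].
by move=> /(@leq_bigmax_seq _ _ xpredT id) /(_ isT) /=; rewrite leqNgt ltnW.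
Qed.

Lemma measurable_infinite_zeros :
  measurable [set w | infinite_set [set j | (0 < j)%N /\ N j w = 0%N]].
Proof.
rewrite infinite_zerosE; apply: measurableC; apply: bigcupT_measurable => m.
exact: measurable_avoid_forever.
Qed.

(** In the [k]-th event the first zero after [m] is at time [k.+1], so these events partition [E]
    minus [avoid m n]. Below, [B] is a zero at time [n] or the whole space. *)
Let first_zero_sum m n E B : (m <= n)%N -> measurable E -> measurable B ->
  \sum_(m <= k < n) pr (E `&` avoid m k `&` zero k.+1 `&` B) =
  pr (E `&` B) - pr (E `&` avoid m n `&` B).
Proof.
move=> + mE mB; elim: n => [|n IH].
  rewrite leqn0 => /eqP ->; rewrite big_geq//; apply/esym/eqP; rewrite subr_eq0.
  rewrite (_ : E `&` avoid 0 0 = E)//; apply/seteqP; split=> w /=; first by case.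
  by move=> Ew; split=> // -[].
rewrite leq_eqVlt => /orP[/eqP ->|].
  rewrite big_geq//; apply/esym/eqP; rewrite subr_eq0.
  rewrite (_ : E `&` avoid n.+1 n.+1 = E)//; apply/seteqP; split=> w /=; first by case.
  by move=> Ew; split=> // i; rewrite ltnNge andNb.
rewrite ltnS => mn; rewrite big_nat_recr//= IH//.
rewrite (@pr_split (E `&` avoid m n `&` B) (zero n.+1))//; last first.
  by apply: measurableI => //; exact: measurableI.
have -> : E `&` avoid m n `&` B `&` zero n.+1 = E `&` avoid m n `&` zero n.+1 `&` B.
  by rewrite setIAC.
have -> : E `&` avoid m n `&` B `\` zero n.+1 = E `&` avoid m n.+1 `&` B.
  by rewrite avoidS//; apply/seteqP; split=> w /=; tauto.
by ring.
Qed.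

(** By [markov_zero] with [a = 0], [expR (- load 1 n)] is the probability of a zero at time [n]
    given [N 1 = 0], so [W m M] is the expected number of zeros in [(m, M]] under that condition. *)
Local Notation W m M := (\sum_(m.+1 <= n < M.+1) expR (- load 1 n)).

(* Decomposing at the first zero: the expected number of zeros in [(m, M]] is at
   most the probability of a zero there times the largest expected number of zeros
   counted from a zero. *)
Lemma zeros_le m M E : (0 < m <= M)%N -> past N m E ->
  \sum_(m.+1 <= n < M.+1) pr (E `&` zero n) <=
  (pr E - pr (E `&` avoid m M)) * (expR 1 * W m M + (1 - r)^-1 ^+ 2).
Proof.
move=> /andP[m0 mM] pE; have mE := measurable_past mN pE.
pose h k := pr (E `&` avoid m k `&` zero k.+1).
have h0 k : 0 <= h k by exact: pr_ge0.
have pH k : (m <= k)%N -> past N k.+1 (E `&` avoid m k `&` zero k.+1).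
  move=> mk; apply: pastI; last exact: past_zero.
  apply: pastI; first by apply: (pastS _ pE); exact: leqW.
  by apply: (pastS _ (@past_avoid m k)).
(* A zero at [n] forces a first zero at some [k.+1 <= n], from which the chain restarts at 0. *)
have step n : (m < n)%N ->
    pr (E `&` zero n) = \sum_(m <= k < n) h k * expR (- load k.+1 n).
  move=> mn; have := first_zero_sum (ltnW mn) mE (mN n 0%N).
  rewrite [X in _ = _ - pr X](_ : _ = set0); last first.
    rewrite -subset0 => w [[_ aw] /= zw]; apply: (aw n) => //.
    by rewrite mn/=.
  rewrite [pr set0]/pr measure0/= subr0 => <-.
  rewrite big_nat [RHS]big_nat; apply: eq_bigr => k /andP[mk kn].
  rewrite (@pr_markov k.+1 n 0%N)//; last exact: pH.
  by rewrite expr0 mul1r mulrC.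
have hE : \sum_(m <= k < M) h k = pr E - pr (E `&` avoid m M).
  have := first_zero_sum mM mE measurableT; rewrite !setIT => <-.
  by apply: eq_bigr => k _; rewrite setIT.
pose F n k := expR 1 * expR (- load 1 n) + (1 - r)^-1 * r ^+ (n - k.+1).
have F0 n k : 0 <= F n k.
  by rewrite addr_ge0 ?mulr_ge0 ?expR_ge0 ?exprn_ge0 ?invr_ge0 ?subr_ge0 ?(ltW r0) ?(ltW r1).
apply: (@le_trans _ _
    (\sum_(m.+1 <= n < M.+1) \sum_(m <= k < M | (k < n)%N) h k * F n k)).
  rewrite big_nat [leRHS]big_nat; apply: ler_sum => n /andP[mn nM].
  rewrite step// (@big_nat_widen _ _ _ m n M)//=.
  rewrite big_nat_cond [leRHS]big_nat_cond.
  apply: ler_sum => k /andP[/andP[mk _] kn].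
  by rewrite ler_wpM2l//; exact: expRN_load_le.
(* Exchanging the sums puts the first zero [k.+1] outside; the inner sum over [n] is bounded
   uniformly in [k], its geometric part giving the second factor [(1 - r)^-1]. *)
rewrite (exchange_big_dep_nat predT)//= -hE mulr_suml big_nat [leRHS]big_nat.
apply: ler_sum => k /andP[mk kM]; rewrite -mulr_sumr ler_wpM2l// big_split/=.
have onemr_ge0 : 0 <= (1 - r)^-1 by rewrite invr_ge0 subr_ge0 ltW.
rewrite -!mulr_sumr lerD//.
  rewrite ler_wpM2l ?expR_ge0// big_mkcond/=; apply: ler_sum => n _.
  by case: ifP => // _; rewrite expR_ge0.
rewrite expr2 ler_wpM2l// -(@big_nat_widenl _ _ _ k.+1 m.+1 M.+1 predT)//.
rewrite -{1}[k.+1]add0n big_addn; under eq_bigr do rewrite addnK.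
by rewrite sum_geometric_le// (ltW r0).
Qed.

Let bernoulli_le (q : R) a : 0 <= q <= 1 -> 1 - a%:R * q <= (1 - q) ^+ a.
Proof.
move=> /andP[q0 q1]; elim: a => [|a IH]; first by rewrite mul0r subr0 expr0.
rewrite exprS -natr1; apply: (@le_trans _ _ ((1 - q) * (1 - a%:R * q))).
  have : 0 <= a%:R * q * q by rewrite !mulr_ge0.
  lra.
by rewrite ler_wpM2l// subr_ge0.
Qed.

(** With [q = r ^+ (n - m)], Bernoulli's inequality and [load m n <= load 1 n] bound the chance of a
    zero at [n] from below by [expR (- load 1 n) - a%:R * q]; the terms [q] sum to at most
    [(1 - r)^-1]. *)
Lemma zeros_ge m M a E : (0 < m)%N -> past N m E -> E `<=` [set w | N m w = a] ->
  pr E * (W m M - a%:R * (1 - r)^-1) <= \sum_(m.+1 <= n < M.+1) pr (E `&` zero n).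
Proof.
move=> m0 pE Ea.
apply: (@le_trans _ _
    (pr E * \sum_(m.+1 <= n < M.+1) (expR (- load 1 n) - a%:R * r ^+ (n - m)))).
  rewrite ler_wpM2l// sumrB lerD2l lerN2 -mulr_sumr ler_wpM2l//.
  rewrite -{1}[m.+1]add0n big_addn.
  apply: le_trans (sum_geometric_le (M.+1 - m.+1) _); last by rewrite (ltW r0).
  apply: ler_sum => i _; rewrite addnS subSn ?leq_addl// addnK exprS.
  by rewrite ler_piMl ?exprn_ge0// ltW.
rewrite mulr_sumr big_nat [leRHS]big_nat; apply: ler_sum => n /andP[mn _].
rewrite (@pr_markov m n a)//; last exact: ltnW.
rewrite [leRHS]mulrC ler_wpM2l//; set q := r ^+ (n - m).
have q01 : 0 <= q <= 1 by rewrite exprn_ge0 ?exprn_ile1 ?(ltW r0) ?(ltW r1).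
have l1 : expR (- load 1 n) <= 1.
  by rewrite expR_le1 oppr_le0 load_ge0 // ltW.
have l2 : expR (- load 1 n) <= expR (- load m n).
  rewrite ler_expR lerN2 (@load_split _ _ _ 1 m n) ?m0 ?(ltnW mn)//.
  by rewrite lerDr mulr_ge0 ?load_ge0 ?exprn_ge0 ?ltW.
have q1 : 0 <= (1 - q) ^+ a by rewrite exprn_ge0// subr_ge0; case/andP: q01.
apply: (@le_trans _ _ ((1 - q) ^+ a * expR (- load 1 n))); last by rewrite ler_wpM2l.
apply: (@le_trans _ _ ((1 - a%:R * q) * expR (- load 1 n))); last first.
  by rewrite ler_wpM2r ?expR_ge0// bernoulli_le.
rewrite [leRHS]mulrBl mul1r lerD2l lerN2 ler_piMr// mulr_ge0//.
by case/andP: q01.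
Qed.

(** The form in which divergence of the series is used; [expRN_load_unbounded] derives it. *)
Hypothesis W_unbounded : forall m (L : R), exists2 M, (m <= M)%N & L <= W m M.

Local Notation delta := ((2 * expR 1)^-1 : R).

(** [zeros_ge] and [zeros_le] together give [pi * (W - D) <= (pi - nu) * (e * W + K)], where [nu] is
    the probability of [E] without a zero in [(m, M]]. *)
Let avoid_forever_state m a E : (0 < m)%N -> past N m E ->
  E `<=` [set w | N m w = a] ->
  pr (E `&` avoid_forever m) <= (1 - delta) * pr E.
Proof.
move=> m0 pE Ea; have mE := measurable_past mN pE.
set e := expR 1; have e0 : 0 < e by exact: expR_gt0.
set K := (1 - r)^-1 ^+ 2; have K0 : 0 < K by rewrite exprn_gt0// invr_gt0 subr_gt0.
set D := a%:R * (1 - r)^-1.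
(* The threshold amounts to [e * W + K <= 2 * e * (W - D)], whence the 2 in [delta]. The choice of
   [M] depends on [a], but [delta] does not. *)
have [M mM Wl] := W_unbounded m (e^-1 * (K + 2 * e * D)).
have W0 : 0 <= W m M by apply: sumr_ge0 => n _; exact: expR_ge0.
have eW : K + 2 * e * D <= e * W m M by rewrite -ler_pdivrMl.
have up : _ <= _ := @zeros_le m M E _ pE; rewrite m0 mM in up.
have {up} := le_trans (zeros_ge M m0 pE Ea) (up isT).
rewrite -/D -/K -/e; set w := W m M in W0 eW *.
have : pr (E `&` avoid_forever m) <= pr (E `&` avoid m M).
  rewrite fine_le ?fin_num_measure//; try by apply: measurableI => //;
    exact: measurable_avoid_forever.
  rewrite le_measure// ?inE; try by apply: measurableI => //;
    exact: measurable_avoid_forever.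
  by move=> x [Ex ax]; split=> // i /andP[mi _]; exact: ax.
set nu := pr (E `&` avoid m M); set nu' := pr (_ `&` _); move=> nun.
set pi := pr E => H.
apply: (le_trans nun).
have pi0 : 0 <= pi by exact: pr_ge0.
have B0 : 0 < e * w + K by rewrite ltr_wpDl// mulr_ge0// ltW.
have : pi * (e * w + K) <= 2 * e * (pi - nu) * (e * w + K).
  have h1 : pi * (e * w + K) <= pi * (2 * e * (w - D)) by rewrite ler_wpM2l//; lra.
  have h2 : 2 * e * (pi * (w - D)) <= 2 * e * ((pi - nu) * (e * w + K)).
    by rewrite ler_wpM2l// mulr_ge0// ltW.
  lra.
rewrite ler_pM2r// => h.
have : delta * pi <= pi - nu by rewrite ler_pdivrMl ?mulr_gt0.
lra.
Qed.

(** Since [delta] is the same for all states, the bound on cylinders extends to events that do not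
    fix [N m]. *)
Lemma avoid_forever_le m E : (0 < m)%N -> past N m E ->
  (P (E `&` avoid_forever m) <= (1 - delta)%:E * P E)%E.
Proof.
move=> m0 pE; apply: (past_prob_le mN pE) => [|w Ew].
  exact: measurable_avoid_forever.
have mC := measurable_cylinder mN m (N^~ w).
rewrite !prE//; last by apply: measurableI => //; exact: measurable_avoid_forever.
rewrite -EFinM lee_fin (@avoid_forever_state m (N m w))//; first exact: past_cylinder.
by move=> w' /= ->.
Qed.

(** Avoiding zero forever after [m] means avoiding it up to [m + i] and forever after that, so its
    probability [x] is at most [1 - delta] times that of [avoid m (m + i)]. Letting [i] grow gives
    [x <= (1 - delta) * x]. *)
Lemma avoid_forever_null m : (0 < m)%N -> P (avoid_forever m) = 0%E.
Proof.
move=> m0; have ma := measurable_avoid_forever m.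
have e1 : 1 < expR 1 :> R by rewrite expR_gt1.
have d0 : 0 < delta by rewrite invr_gt0 mulr_gt0 ?expR_gt0.
have step i : (P (avoid_forever m) <= (1 - delta)%:E * P (avoid m (m + i)))%E.
  rewrite -(_ : avoid m (m + i) `&` avoid_forever (m + i) = avoid_forever m).
    by apply: avoid_forever_le; [rewrite addn_gt0 m0|exact: past_avoid].
  apply/seteqP; split=> w /=.
    move=> [a1 a2] j mj; have [jm|jm] := leqP j (m + i); last exact: a2.
    by apply: a1; rewrite mj.
  move=> aw; split=> [j /andP[mj _]|j mj]; first exact: aw.
  by apply: aw; exact: leq_ltn_trans (leq_addr i m) mj.
have avE : avoid_forever m = \bigcap_i avoid m (m + i).
  apply/seteqP; split=> w /= aw; first by move=> i _ j /andP[mj _]; exact: aw.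
  by move=> i mi; apply: (aw i) => //; rewrite mi leq_addl.
have cv : P (avoid m (m + i)) @[i --> \oo] --> P (avoid_forever m).
  rewrite avE; apply: (@nonincreasing_cvg_mu _ _ _ P (fun i => avoid m (m + i))) => //.
  - by rewrite (le_lt_trans (probability_le1 _ _)) ?ltry.
  - by rewrite -avE.
  - move=> i j ij; apply/subsetPset => w aw k /andP[mk kj]; apply: aw.
    by rewrite mk (leq_trans kj)// leq_add2l.
have {cv} cv : ((1 - delta)%:E * P (avoid m (m + i)))%E @[i --> \oo] -->
    ((1 - delta)%:E * P (avoid_forever m))%E by exact: cvgeZl.
have : (P (avoid_forever m) <= (1 - delta)%:E * P (avoid_forever m))%E.
  rewrite -(cvg_lim _ cv)//; apply: lime_ge; first by apply/cvg_ex; eexists; exact: cv.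
  exact: nearW.
rewrite prE// -EFinM lee_fin => h; congr EFin; apply/eqP; rewrite eq_le pr_ge0 andbT.
have : delta * pr (avoid_forever m) <= 0 by lra.
by rewrite pmulr_rle0.
Qed.

Lemma infinitely_many_zeros :
  P [set w | infinite_set [set j | (0 < j)%N /\ N j w = 0%N]] = 1%E.
Proof.
have mU : measurable (\bigcup_m avoid_forever m.+1).
  by apply: bigcupT_measurable => m; exact: measurable_avoid_forever.
rewrite infinite_zerosE probability_setC//.
suff -> : P (\bigcup_m avoid_forever m.+1) = 0%E by rewrite sube0.
apply: measure_negligible => //; apply: negligible_bigcup => m.
by apply/negligibleP; [exact: measurable_avoid_forever|exact: avoid_forever_null].
Qed.

End Returns.

(** * Convergence and divergence of the series *)

Section Dichotomy.
Context {R : realType} {d : measure_display} {T : measurableType d}.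
Variables (P : probability T R) (p : R) (f : nat -> R) (N : nat -> T -> nat).
Hypotheses (p_gt : 1 / 2 < p) (p_lt1 : p < 1).
Hypothesis f_ge0 : forall j, (0 < j)%N -> 0 <= f j.
Hypothesis chainN : is_chain P p f N.
Local Notation r := ((1 - p) / p).
Local Notation zero n := [set w | N n w = 0%N].
Local Notation zeros w := [set j | (0 < j)%N /\ N j w = 0%N].
Local Notation u j := (expR (- ((1 - p) / (2 * p - 1) * f j))).
Local Notation S := (\sum_(1 <= j <oo) (u j)%:E)%E.

Let mN := chainN.1.
Let r0 : 0 < r := ratio_gt0 p_gt p_lt1.
Let r1 : r < 1 := ratio_lt1 p_gt.

Lemma mean_ratioE : (1 - p) / (2 * p - 1) = r / (1 - r).
Proof.
have p0 : 0 < p by rewrite (lt_trans _ p_gt)// divr_gt0.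
have p21 : 2 * p - 1 != 0.
  by rewrite gt_eqF// subr_gt0 mulrC -ltr_pdivrMr.
have -> : 1 - r = (2 * p - 1) / p by field; rewrite gt_eqF.
by field; rewrite p21 gt_eqF.
Qed.

Let S_ge k : (\sum_(1 <= j < k) (u j)%:E <= S)%E.
Proof. by apply: nneseries_lim_ge => j _ _; rewrite lee_fin expR_ge0. Qed.

(** Time 1 is the first from which the Markov formula applies; the factor for the individuals
    present then is at most 1. *)
Lemma prob_zero_le n : (P (zero n.+1) <= (expR (- load r f 1 n.+1))%:E)%E.
Proof.
have -> : zero n.+1 = setT `&` zero n.+1 by rewrite setTI.
rewrite -[leRHS]mule1 -(probability_setT P).
apply: (@past_prob_le _ _ _ P N mN 1) => // w _.
rewrite -{1}[n.+1]add1n (markov_cylinder_zero p_gt p_lt1 f_ge0 chainN)// add1n.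
rewrite lee_wpmul2r// lee_fin ler_piMl ?expR_ge0//.
rewrite exprn_ile1 ?subr_ge0 ?exprn_ile1 ?(ltW r0) ?(ltW r1)//.
by rewrite gerBl exprn_ge0// ltW.
Qed.

Lemma finitely_many_zeros : S != +oo%E ->
  P [set w | infinite_set (zeros w)] = 0%E.
Proof.
move=> Soo.
have Sfin : S \is a fin_num.
  rewrite fin_numE Soo andbT gt_eqF//; apply: lt_le_trans (ltNyr 0) _.
  by apply: nneseries_ge0 => j _ _; rewrite lee_fin expR_ge0.
have null : P (lim_sup_set (fun n => zero n.+1)) = 0%E.
  apply: lim_sup_set_cvg0 => //.
  (* The constant is the bound on the partial sums that [sum_expRN_load] gives once the sum of [u]
     is replaced by [S]. *)
  apply: (@le_lt_trans _ _ ((1 - r)^-1 * (1 + (1 - r) * fine S))%:E); last exact: ltry.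
  apply: lime_le; first exact: is_cvg_nneseries.
  apply: nearW => n.
  apply: (@le_trans _ _ (\sum_(0 <= i < n) (expR (- load r f 1 i.+1))%:E)%E).
    by apply: lee_sum => i _; exact: prob_zero_le.
  rewrite sumEFin lee_fin -ler_pdivrMl ?invr_gt0 ?subr_gt0// invrK.
  have := @sum_expRN_load _ r f r0 r1 n; rewrite -mean_ratioE big_add1/= => h.
  have h1 : \sum_(1 <= k < n.+1) u k <= fine S.
    by rewrite -lee_fin fineK// -sumEFin; exact: S_ge.
  have h2 : (1 - r) * \sum_(1 <= k < n.+1) u k <= (1 - r) * fine S.
    by rewrite ler_wpM2l// subr_ge0 ltW.
  have := expR_ge0 (- load r f 1 n.+1); move: h h2; lra.
apply/eqP; rewrite eq_le measure_ge0 andbT.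
(* Positive times are written [n.+1]; if no zero came from some such time on, there would be only
   finitely many. *)
have sub : [set w | infinite_set (zeros w)] `<=` lim_sup_set (fun n => zero n.+1).
  move=> w iw n _; apply: contrapT => nw; apply: iw.
  apply: (@sub_finite_set _ _ `I_n.+1); last exact: finite_II.
  move=> [|j] [//= _ zj]; rewrite ltnS ltnNge; apply/negP => nj; apply: nw.
  by exists j.
rewrite -null le_measure ?inE//; first exact: measurable_infinite_zeros chainN.
by apply: bigcapT_measurable => n; apply: bigcup_measurable => k _; exact: mN.
Qed.

Hypothesis f_nd : forall i j, (0 < i)%N -> (i <= j)%N -> f i <= f j.

Lemma expRN_load_unbounded : S = +oo%E -> forall m (L : R),
  exists2 M, (m <= M)%N & L <= \sum_(m.+1 <= n < M.+1) expR (- load r f 1 n).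
Proof.
move=> Soo m L; apply: contrapT => H.
(* If all the sums from [m.+1] stayed below [L], so would those of [u], as [load 1 n <= c * f n];
   the first [m] terms of the series are then added. *)
suff : (S <= (L + \sum_(1 <= j < m.+1) u j)%:E)%E by rewrite Soo leye_eq.
apply: lime_le.
  by apply: is_cvg_nneseries => j _ _; rewrite lee_fin expR_ge0.
exists m.+1 => // -[//|M] /= mM; rewrite sumEFin lee_fin.
rewrite (@big_cat_nat _ _ _ m.+1)//= addrC lerD2r.
have [//|] := leP (\sum_(m.+1 <= i < M.+1) u i) L.
move=> /ltW LM; exfalso; apply: H; exists M => //.
apply: (le_trans LM); rewrite big_nat [leRHS]big_nat; apply: ler_sum => n /andP[mn _].
by rewrite ler_expR lerN2 mean_ratioE load_le// (leq_ltn_trans (leq0n m)).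
Qed.

End Dichotomy.

Theorem theorem4 (R : realType) (p : R) (f : nat -> R)
  (d : measure_display) (T : measurableType d) (P : probability T R)
  (N : nat -> T -> nat) :
  1 / 2 < p -> p < 1 ->
  (forall j, (0 < j)%N -> 0 <= f j) ->
  (forall i j, (0 < i)%N -> (i <= j)%N -> f i <= f j) ->
  is_chain P p f N ->
  let Kinf := [set w | infinite_set [set j | (0 < j)%N /\ N j w = 0%N]] in
  let S := (\sum_(1 <= j <oo) (expR (- ((1 - p) / (2 * p - 1) * f j)))%:E)%E in
  (P Kinf = 1%E <-> S = +oo%E) /\
  (S != +oo%E -> P Kinf = 0%E).
Proof.
move=> p_gt p_lt1 f_ge0 f_nd chainN Kinf S.
have fin : S != +oo%E -> P Kinf = 0%E by exact: finitely_many_zeros.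
split=> //; split=> [K1|Soo].
  by apply/eqP/negPn/negP => /fin; rewrite K1 => /eqP; rewrite onee_eq0.
apply: (infinitely_many_zeros p_gt p_lt1 f_ge0 f_nd chainN).
exact: expRN_load_unbounded.
Qed.
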